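(* Let $L$ be a directly indecomposable residuated lattice satisfying the descending chain condition on filters. Then $L$ is subdirectly irreducible if and only if the topology $\mathcal{T}=\{U\subseteq L:\forall x\in U\ \exists F\in\mathcal{F}(L)\setminus\{\{1\}\},\ x/F\subseteq U\}$ induced on $L$ by its global system of filters $\mathcal{F}(L)\setminus\{\{1\}\}$ is not discrete.
   Context: A residuated lattice is an algebra $(L,\wedge,\vee,\odot,\rightarrow,0,1)$ such that $(L,\wedge,\vee,0,1)$ is a bounded lattice, $(L,\odot,1)$ is a commutative monoid, and $x\odot y\le z$ iff $x\le y\rightarrow z$. A filter is a nonempty subset closed under $\odot$ and upward closed; $\mathcal{F}(L)\setminus\{\{1\}\}$ is the set of all filters other than $\{1\}$. For a filter $F$, $x/F$ is the class of $x$ under the congruence $\theta_F=\{(x,y):(x\rightarrow y)\odot(y\rightarrow x)\in F\}$. The descending chain condition means every strictly descending chain of filters is finite. $L$ is directly indecomposable if it is not isomorphic to a direct product of two nontrivial algebras. $L$ is subdirectly irreducible if it is trivial or its congruence lattice has a minimum element among congruences different from the identity relation (equivalently, $\mathcal{F}(L)\setminus\{\{1\}\}$ has a minimum element).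
   Formalization: The topology is taken to be the one generated by the displayed family (its closure under unions and binary intersections), since the displayed family need not be closed under intersections and never contains {1}; the two agree whenever the family is a topology. *)

(* Defs.v *)
From HB Require Import structures.
From mathcomp Require Import all_boot all_order.
From mathcomp Require Import boolp classical_sets.

Set Implicit Arguments.
Unset Strict Implicit.
Unset Printing Implicit Defensive.

Import Order.TTheory.
Local Open Scope classical_set_scope.
Local Open Scope order_scope.

Reserved Notation "x \odot y" (at level 40, left associativity).
Reserved Notation "x \imp y" (at level 55, right associativity).

(* 0 and 1 are the bounds \bot and \top of the lattice; the trivial algebra
   (\bot = \top) is allowed. *)
HB.mixin Record isResiduated d L of Order.TBLattice d L := {
  rmul : L -> L -> L;
  rimp : L -> L -> L;
  rmulA : associative rmul;
  rmulC : commutative rmul;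
  rmul1x : left_id \top rmul;
  rmul_le : forall x y z, (rmul x y <= z) = (x <= rimp y z)
}.

#[short(type="residuatedLatticeType")]
HB.structure Definition ResiduatedLattice d :=
  { L of isResiduated d L & Order.TBLattice d L }.

Notation "x \odot y" := (rmul x y) : order_scope.
Notation "x \imp y" := (rimp x y) : order_scope.

Section DirectProduct.
Context {dA dB : Order.disp_t}.
Variables (A : residuatedLatticeType dA) (B : residuatedLatticeType dB).
Implicit Types u v w : A *p B.

Definition prod_rmul u v : A *p B := (u.1 \odot v.1, u.2 \odot v.2).
Definition prod_rimp u v : A *p B := (u.1 \imp v.1, u.2 \imp v.2).

Lemma prod_rmulA : associative prod_rmul.
Proof. by move=> u v w; rewrite /prod_rmul /= !rmulA. Qed.

Lemma prod_rmulC : commutative prod_rmul.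
Proof. by move=> u v; rewrite /prod_rmul (rmulC u.1) (rmulC u.2). Qed.

Lemma prod_rmul1x : left_id \top prod_rmul.
Proof. by case=> a b; rewrite /prod_rmul /= !rmul1x. Qed.

Lemma prod_rmul_le u v w : (prod_rmul u v <= w) = (u <= prod_rimp v w).
Proof. by rewrite !Order.ProdOrder.leEprod /= !rmul_le. Qed.

HB.instance Definition _ :=
  isResiduated.Build _ (A *prod[Order.prod_display dA dB] B)
    prod_rmulA prod_rmulC prod_rmul1x prod_rmul_le.

End DirectProduct.

Record isomorphism {dL dM : Order.disp_t} (L : residuatedLatticeType dL)
    (M : residuatedLatticeType dM) (f : L -> M) : Prop := {
  iso_bij : bijective f;
  iso_meet : {morph f : x y / x `&` y};
  iso_join : {morph f : x y / x `|` y};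
  iso_mul : {morph f : x y / x \odot y};
  iso_imp : {morph f : x y / x \imp y};
  iso_bot : f \bot = \bot;
  iso_top : f \top = \top
}.

Definition isomorphic {dL dM : Order.disp_t} (L : residuatedLatticeType dL)
  (M : residuatedLatticeType dM) : Prop := exists f : L -> M, isomorphism f.

Section ResiduatedLatticeNotions.
Context {d : Order.disp_t}.
Variable L : residuatedLatticeType d.
Implicit Types (x y : L) (F G U : set L) (R : L -> L -> Prop).

Definition trivial_algebra : Prop := forall x y, x = y.

Record congruence R : Prop := {
  cong_refl : forall x, R x x;
  cong_sym : forall x y, R x y -> R y x;
  cong_trans : forall x y z, R x y -> R y z -> R x z;
  cong_meet : forall x x' y y', R x x' -> R y y' -> R (x `&` y) (x' `&` y');
  cong_join : forall x x' y y', R x x' -> R y y' -> R (x `|` y) (x' `|` y');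
  cong_mul : forall x x' y y', R x x' -> R y y' -> R (x \odot y) (x' \odot y');
  cong_imp : forall x x' y y', R x x' -> R y y' -> R (x \imp y) (x' \imp y')
}.

Definition subdirectly_irreducible : Prop :=
  trivial_algebra \/
  exists R0, [/\ congruence R0, R0 <> eq &
    forall R, congruence R -> R <> eq -> forall x y, R0 x y -> R x y].

Definition is_filter F : Prop :=
  [/\ F !=set0,
      forall x y, F x -> F y -> F (x \odot y) &
      forall x y, F x -> x <= y -> F y].

Definition global_system : set (set L) :=
  [set F | is_filter F /\ F <> [set \top]].

Definition filter_class F x : set L :=
  [set y | F ((x \imp y) \odot (y \imp x))].

Definition filter_dcc : Prop :=
  ~ exists F : nat -> set L,
      forall n, is_filter (F n) /\ F n.+1 `<` F n.

Definition coset_open : set (set L) :=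
  [set U | forall x, U x ->
     exists2 F, global_system F & filter_class F x `<=` U].

End ResiduatedLatticeNotions.

Arguments trivial_algebra {d} L.
Arguments subdirectly_irreducible {d} L.
Arguments global_system {d} L.
Arguments filter_dcc {d} L.
Arguments coset_open {d} L.

Definition directly_indecomposable {d : Order.disp_t}
    (L : residuatedLatticeType d) : Prop :=
  ~ exists (dA dB : Order.disp_t) (A : residuatedLatticeType dA)
      (B : residuatedLatticeType dB),
      [/\ ~ trivial_algebra A, ~ trivial_algebra B & isomorphic L (A *p B)].

Section InducedTopology.
Context {X : Type}.
Implicit Types O : set (set X).

Definition open_closed O : Prop :=
  (forall S : set (set X), S `<=` O -> O (\bigcup_(U in S) U)) /\
  (forall U V, O U -> O V -> O (U `&` V)).

Definition discrete O : Prop := forall U : set X, O U.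

End InducedTopology.

(* coset_open L is the family T of the informal definition.  It is always
   closed under unions, but two filters other than {1} may meet in {1}, and
   then it is not closed under intersections: {1} itself is never in it.
   So T is read as a generating family of open sets.  The whole space need
   not be added: it is in coset_open L as soon as L is not trivial
   (coset_openT).  On the trivial algebra there is no filter other than {1},
   and induced_topology L = coset_open L = {set0}. *)
Definition induced_topology {d : Order.disp_t} (L : residuatedLatticeType d) :
    set (set L) :=
  smallest open_closed (coset_open L).
Arguments induced_topology {d} L.

Section Sanity.
Context {d : Order.disp_t}.
Variable L : residuatedLatticeType d.

Lemma coset_open_bigcup (S : set (set L)) :
  S `<=` coset_open L -> coset_open L (\bigcup_(U in S) U).
Proof.
move=> SO x [U SU Ux]; have [F gF FU] := SO U SU x Ux.
by exists F => // y /FU Uy; exists U.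
Qed.

Lemma coset_openT : ~ trivial_algebra L -> coset_open L setT.
Proof.
move=> Lnt x _; exists setT => //; split; first by split=> //; exists \top.
move=> LT; apply: Lnt => y z.
have: [set: L] y by []. have: [set: L] z by [].
by rewrite LT /= => -> ->.
Qed.

Lemma coset_open_top : ~ coset_open L [set \top].
Proof.
move=> /(_ \top erefl) [F [[[z Fz] Fm Fu] Fn] FT]; apply: Fn.
have F1 : F \top by apply: Fu Fz (lex1 z).
apply/seteqP; split => [y Fy|y -> //]; apply: FT.
have y1 : y \imp \top = \top by apply/le_anti; rewrite lex1 -rmul_le lex1.
rewrite /filter_class /= y1 rmulC rmul1x; apply: Fu Fy _.
by rewrite -rmul_le rmulC rmul1x.
Qed.

(* When the family T is a topology, it is the induced topology. *)
Lemma induced_topology_id :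
  (forall U V, coset_open L U -> coset_open L V -> coset_open L (U `&` V)) ->
  induced_topology L = coset_open L.
Proof.
move=> TI; apply: smallest_id; split=> //; exact: coset_open_bigcup.
Qed.

End Sanity.

(* Main.v *)
Require Import Defs.
From mathcomp Require Import all_boot all_order.
From mathcomp Require Import boolp classical_sets.

(* Every basic open set is saturated for the least nontrivial congruence of a
   subdirectly irreducible L, and saturation survives unions and intersections;
   so if all singletons are open that congruence is equality.  Conversely, let F
   be a minimal filter other than {1}, given by the chain condition.  If some
   filter G other than {1} does not contain F, then F and G meet in {1} by
   minimality, and {x} = x/F `&` x/G is open for every x.  Hence F is the least
   filter other than {1}, and theta_F the least nontrivial congruence. *)

Set Implicit Arguments.
Unset Strict Implicit.
Unset Printing Implicit Defensive.

Import Order.TTheory.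
Local Open Scope classical_set_scope.
Local Open Scope order_scope.

Section ResiduatedLatticeTheory.
Context {d : Order.disp_t} {L : residuatedLatticeType d}.
Implicit Types (x y z : L) (F G U : set L) (R : L -> L -> Prop).

(** * Arithmetic of residuation *)

Lemma rmulx1 x : x \odot \top = x.
Proof. by rewrite rmulC rmul1x. Qed.

Lemma rmul_impl x y : (x \imp y) \odot x <= y.
Proof. by rewrite rmul_le. Qed.

Lemma le_rmull x y z : x <= y -> x \odot z <= y \odot z.
Proof. by move=> xy; rewrite rmul_le (le_trans xy)// -rmul_le. Qed.

Lemma le_rmul x x' y y' : x <= x' -> y <= y' -> x \odot y <= x' \odot y'.
Proof.
move=> xx' yy'; apply: le_trans (le_rmull _ xx') _.
by rewrite ![x' \odot _]rmulC le_rmull.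
Qed.

Lemma rmul_leLl x y : x \odot y <= x.
Proof. by rewrite -[leRHS]rmulx1 le_rmul ?lex1. Qed.

Lemma rmul_leLr x y : x \odot y <= y.
Proof. by rewrite rmulC rmul_leLl. Qed.

Lemma rimp_eq1 x y : (x \imp y == \top) = (x <= y).
Proof. by rewrite -[x in RHS]rmul1x rmul_le le1x. Qed.

Lemma rimpxx x : x \imp x = \top.
Proof. by apply/eqP; rewrite rimp_eq1. Qed.

Lemma biimp_eq1 x y : (x \imp y) \odot (y \imp x) = \top -> x = y.
Proof.
move=> e; apply/le_anti; rewrite -!rimp_eq1 -!le1x -e.
by rewrite rmul_leLl rmul_leLr.
Qed.

(** * Filters and the system of filters other than {1} *)

Lemma filter_top F : is_filter F -> F \top.
Proof. by move=> [[x Fx] _ Fu]; apply: Fu Fx (lex1 x). Qed.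

Lemma filterT : is_filter [set: L].
Proof. by split=> //; exists \top. Qed.

Lemma filterI F G : is_filter F -> is_filter G -> is_filter (F `&` G).
Proof.
move=> fF fG; have [_ Fm Fu] := fF; have [_ Gm Gu] := fG.
split=> [|x y [Fx Gx] [Fy Gy]|x y [Fx Gx] xy].
- by exists \top; split; apply: filter_top.
- by split; [apply: Fm|apply: Gm].
- by split; [apply: Fu xy|apply: Gu xy].
Qed.

Lemma global_system_nontop F :
  global_system L F -> exists2 x, F x & x <> \top.
Proof.
move=> [fF Fn]; apply: contra_notP Fn => nx; apply/seteqP; split=> [x Fx|x ->].
- by apply: contra_notP nx => xn; exists x.
- exact: filter_top.
Qed.

Lemma global_systemT : ~ trivial_algebra L -> global_system L [set: L].
Proof.
move=> Ln; split; first exact: filterT.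
move=> LT; apply: Ln => x y.
have all_top z : z = \top by have: [set: L] z by []; rewrite LT.
by rewrite (all_top x) (all_top y).
Qed.

(** The order of the quotient by [F], pulled back to [L]: for a filter it amounts to [F (x \imp y)].
    With an explicit witness [f], compatibility with an operation is proved by multiplying two
    witnesses. *)
Definition filter_le F x y := exists2 f, F f & f \odot x <= y.

(** * The congruence of a filter *)

Section FilterCongruence.
Variable F : set L.
Hypothesis fF : is_filter F.

Lemma filter_classE x y :
  filter_class F x y <-> filter_le F x y /\ filter_le F y x.
Proof.
have [_ Fm Fu] := fF; split=> [Fxy|[[f Ff fx] [g Fg gy]]].
  split; exists ((x \imp y) \odot (y \imp x)) => //; rewrite rmul_le.
  - exact: rmul_leLl.
  - exact: rmul_leLr.
by apply: (Fu (f \odot g)); [apply: Fm|rewrite le_rmul -?rmul_le].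
Qed.

Lemma filter_le_trans x y z :
  filter_le F x y -> filter_le F y z -> filter_le F x z.
Proof.
have [_ Fm _] := fF; move=> [f Ff fx] [g Fg gy]; exists (g \odot f).
  exact: Fm.
by rewrite -rmulA (le_trans _ gy) // le_rmul.
Qed.

Lemma filter_leI x x' y y' : filter_le F x x' -> filter_le F y y' ->
  filter_le F (x `&` y) (x' `&` y').
Proof.
have [_ Fm _] := fF; move=> [f Ff fx] [g Fg gy]; exists (f \odot g).
  exact: Fm.
rewrite lexI; apply/andP; split.
- by apply: le_trans fx; rewrite le_rmul ?leIl ?rmul_leLl.
- by apply: le_trans gy; rewrite le_rmul ?leIr ?rmul_leLr.
Qed.

Lemma filter_leU x x' y y' : filter_le F x x' -> filter_le F y y' ->
  filter_le F (x `|` y) (x' `|` y').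
Proof.
have [_ Fm _] := fF; move=> [f Ff fx] [g Fg gy]; exists (f \odot g).
  exact: Fm.
(* Residuation moves [f \odot g] to the right, so the join left alone splits by [leUx]. *)
rewrite rmulC rmul_le leUx -!rmul_le ![_ \odot (f \odot g)]rmulC.
apply/andP; split.
- by rewrite (le_trans _ (leUl _ _))// (le_trans _ fx)// le_rmul ?rmul_leLl.
- by rewrite (le_trans _ (leUr _ _))// (le_trans _ gy)// le_rmul ?rmul_leLr.
Qed.

Lemma filter_leM x x' y y' : filter_le F x x' -> filter_le F y y' ->
  filter_le F (x \odot y) (x' \odot y').
Proof.
have [_ Fm _] := fF; move=> [f Ff fx] [g Fg gy]; exists (f \odot g).
  exact: Fm.
by rewrite -rmulA (rmulA g) (rmulC g) -(rmulA x) rmulA le_rmul.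
Qed.

Lemma filter_le_imp x x' y y' : filter_le F x' x -> filter_le F y y' ->
  filter_le F (x \imp y) (x' \imp y').
Proof.
have [_ Fm _] := fF; move=> [f Ff fx] [g Fg gy]; exists (g \odot f).
  exact: Fm.
(* After residuation, [f] takes [x'] below [x], modus ponens leads to [y], and [g] takes [y] below
   [y']. *)
rewrite -rmul_le -rmulA (le_trans _ gy)// -rmulA le_rmul//.
rewrite rmulA (rmulC f) -rmulA (le_trans _ (rmul_impl x y))//.
by rewrite le_rmul.
Qed.

Lemma filter_class_congruence : congruence (filter_class F).
Proof.
split.
- by move=> x; rewrite /filter_class /= rimpxx rmul1x; apply: filter_top.
- by move=> x y; rewrite /filter_class /= rmulC.
- move=> x y z /filter_classE[xy yx] /filter_classE[yz zy].
  apply/filter_classE; split.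
  + exact: filter_le_trans xy yz.
  + exact: filter_le_trans zy yx.
- move=> x x' y y' /filter_classE[? ?] /filter_classE[? ?].
  by apply/filter_classE; split; apply: filter_leI.
- move=> x x' y y' /filter_classE[? ?] /filter_classE[? ?].
  by apply/filter_classE; split; apply: filter_leU.
- move=> x x' y y' /filter_classE[? ?] /filter_classE[? ?].
  by apply/filter_classE; split; apply: filter_leM.
- move=> x x' y y' /filter_classE[? ?] /filter_classE[? ?].
  by apply/filter_classE; split; apply: filter_le_imp.
Qed.

End FilterCongruence.

(** Each element of [F] is congruent to [\top], and some element of [F] is not [\top]. *)
Lemma filter_class_neq_eq F : global_system L F -> filter_class F <> eq.
Proof.
move=> gF Fe; have [x Fx xn] := global_system_nontop gF.
apply: xn; rewrite -Fe; apply/(filter_classE gF.1); split.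
- by exists \top; [exact: filter_top gF.1|exact: lex1].
- by exists x => //; rewrite rmulx1.
Qed.

(** * The filter of a congruence *)

Definition cong_filter R : set L := [set x | R x \top].

Lemma is_filter_cong_filter R : congruence R -> is_filter (cong_filter R).
Proof.
move=> cR; split=> [|x y Rx Ry|x y Rx xy].
- by exists \top; apply: (cong_refl cR).
- by rewrite /cong_filter /= -[\top]rmulx1; apply: (cong_mul cR).
- rewrite /cong_filter /= -(join_r xy) -[\top](join1x y).
  by apply: (cong_join cR) => //; apply: (cong_refl cR).
Qed.

Lemma filter_class_cong_filter R x y : congruence R ->
  filter_class (cong_filter R) x y <-> R x y.
Proof.
move=> cR; have rR := cong_refl cR; split; last first.
  move=> Rxy; rewrite /filter_class /cong_filter /= -[\top]rmulx1.
  apply: (cong_mul cR).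
  - by rewrite -(rimpxx y); apply: (cong_imp cR).
  - by rewrite -(rimpxx y); apply: (cong_imp cR).
(* As [u \imp v] is congruent to [\top], [(u \imp v) \odot u] is congruent to [u]; it lies below
   [v], so joining both with [v] gives the claim. *)
have half u v : cong_filter R (u \imp v) -> R v (u `|` v).
  move=> Ruv; rewrite -{1}(join_r (rmul_impl u v)).
  by apply: (cong_join cR) => //; rewrite -{3}[u]rmul1x; apply: (cong_mul cR).
have [_ _ Ru] := is_filter_cong_filter cR.
move=> Rxy; apply: (cong_trans cR (y := x `|` y)).
- by rewrite joinC; apply: half; apply: Ru Rxy (rmul_leLr _ _).
- by apply: (cong_sym cR); apply: half; apply: Ru Rxy (rmul_leLl _ _).
Qed.

(** A congruence is recovered from its filter, and the filter {1} gives back equality. *)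
Lemma global_system_cong_filter R :
  congruence R -> R <> eq -> global_system L (cong_filter R).
Proof.
move=> cR Rn; split; first exact: is_filter_cong_filter.
move=> RT; apply: Rn; apply/funext => x; apply/funext => y.
apply/propext; split=> [/(filter_class_cong_filter _ _ cR)|->].
- by rewrite RT => /biimp_eq1.
- exact: (cong_refl cR).
Qed.

(** * Open classes, minimal filters and discreteness *)

Lemma filter_class_open F x :
  global_system L F -> coset_open L (filter_class F x).
Proof.
move=> gF y Fxy; exists F => // z Fyz.
exact: (cong_trans (filter_class_congruence gF.1) Fxy Fyz).
Qed.

Lemma filter_dcc_minimal : filter_dcc L -> ~ trivial_algebra L ->
  exists2 F, global_system L F &
    forall G, global_system L G -> G `<=` F -> F `<=` G.
Proof.
move=> dcc Ln; apply: contrapT => nomin; apply: dcc.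
(* The membership hypothesis sits under the existential so that [choice] yields a total function;
   outside the system, [F] itself is a dummy value. Iterating from the whole of [L] gives the
   forbidden chain. *)
have smaller F : exists G,
    global_system L F -> global_system L G /\ G `<` F.
  have [gF|ngF] := pselect (global_system L F); last by exists F.
  apply: contrapT => nG; apply: nomin; exists F => // G gG GF.
  by apply: contrapT => nFG; apply: nG; exists G.
have [g gP] := choice smaller.
have gn n : global_system L (iter n g setT).
  elim: n => [|n IHn]; first exact: global_systemT.
  exact: (gP _ IHn).1.
exists (fun n => iter n g setT) => n.
by split; [exact: (gn n).1|exact: (gP _ (gn n)).2].
Qed.

(** The [R]-saturated sets are one of the families over which [smallest] takes the intersection. The
    hypothesis on [R] makes the generators saturated. *)
Lemma induced_topology_saturated R U :
    (forall F, global_system L F -> forall x y, R x y -> filter_class F x y) ->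
  induced_topology L U -> forall x y, R x y -> U x -> U y.
Proof.
move=> RF; pose S : set (set L) := [set V | forall x y, R x y -> V x -> V y].
move=> /(_ S); apply; split.
- split=> [T TS x y Rxy [V TV Vx]|V W SV SW x y Rxy [Vx Wx]].
  + by exists V => //; apply: TS Rxy Vx.
  + by split; [apply: SV Vx|apply: SW Wx].
- by move=> V oV x y Rxy /oV[F gF]; apply; apply: RF.
Qed.

Lemma discrete_induced_topology F G : global_system L F -> global_system L G ->
  F `&` G = [set \top] -> discrete (induced_topology L).
Proof.
(* [S] is any family closed under unions and intersections that contains the generators. *)
move=> gF gG FG U S [[SU SI] oS].
rewrite (_ : U = \bigcup_(V in [set [set x] | x in U]) V).
  apply: SU => _ [x Ux <-].
  rewrite (_ : [set x] = filter_class F x `&` filter_class G x).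
    by apply: SI; apply: oS; apply: filter_class_open.
  apply/seteqP; split=> [_ ->|y [Fxy Gxy]].
  - by split; apply: cong_refl (filter_class_congruence _) _;
      [case: gF|case: gG].
  - have : (F `&` G) ((x \imp y) \odot (y \imp x)) by [].
    by rewrite FG => /biimp_eq1 ->.
apply/seteqP; split=> [x Ux|x [_ [y Uy <-] ->]//].
by exists [set x] => //; exists x.
Qed.

End ResiduatedLatticeTheory.

Theorem theorem4p13 (d : Order.disp_t) (L : residuatedLatticeType d)
    (L_indec : directly_indecomposable L) (L_dcc : filter_dcc L) :
  subdirectly_irreducible L <-> ~ discrete (induced_topology L).
Proof.
split=> [[Ltriv|[R0 [cR0 R0n R0min]]] disc|ndisc].
- have noF F : global_system L F -> False.
    by move=> /global_system_nontop[x _]; apply; apply: Ltriv.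
  apply: (disc setT [set U | ~ U \top]) => //; split; last first.
    by move=> U oU /oU[F /noF].
  by split=> [S SS [U SU]|U V Un _ [/Un]//]; apply: SS SU.
- apply: R0n; apply/funext => x; apply/funext => y.
  apply/propext; split=> [R0xy|->]; last exact: (cong_refl cR0).
  (* Saturation of the open singleton of [x] puts [y] in it. *)
  apply/esym; apply: (induced_topology_saturated _ (disc [set x]) R0xy) => //.
  move=> F gF; apply: R0min; last exact: filter_class_neq_eq.
  exact: filter_class_congruence gF.1.
have [Ltriv|Ln] := pselect (trivial_algebra L); [by left|right].
have [F gF Fmin] := filter_dcc_minimal L_dcc Ln.
exists (filter_class F); split.
- exact: filter_class_congruence gF.1.
- exact: filter_class_neq_eq.
(* It remains to carry the biimplication of [x] and [y] from [F] to the filter of [R]. *)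
move=> R cR Rn x y Fxy; apply/(filter_class_cong_filter _ _ cR).
have gR := global_system_cong_filter cR Rn.
have FI : is_filter (F `&` cong_filter R) by apply: filterI gF.1 gR.1.
(* If the meet is not {1}, minimality puts [F] inside it; if it is {1}, the topology is discrete. *)
have [//|FGT] := pselect (global_system L (F `&` cong_filter R)).
  move=> gI; have [//|_ FR] := Fmin _ gI _ _ Fxy; exact: subIsetl.
exfalso; apply: ndisc; apply: discrete_induced_topology gF gR _.
by apply: contrapT => FGn; apply: FGT.
Qed.
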